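(* Let $N,n\ge 1$ be integers, $T>0$, $\lambda>0$, $\xi\in\mathbb{R}^n$, $A_1,\dots,A_N\in\mathbb{R}^{n\times n}$, and let $Q\in\mathbb{R}^{n\times n}$ be positive definite. Let $\psi:\mathbb{R}^N\to\mathbb{R}$ satisfy: (1) there exist measurable functions $\psi_i:\mathbb{R}\to\mathbb{R}$, $i=1,\dots,N$, such that $\psi(u)=\sum_{i=1}^N\psi_i(u_i)$ for all $u=[u_1,\dots,u_N]^\top\in\mathbb{R}^N$; (2) $\psi_i(0)=\psi_i(1)=0$ for all $i$; (3) $\psi_i(s)>0$ for all $s\in(0,1)$ and all $i$. Then any optimal solution $u^\ast$ to the relaxed problem is an optimal solution to the original discrete-valued problem (both problems are defined in the context).
   Context: Controls are measurable functions $u=[u_1,\dots,u_N]^\top$ from $[0,T]$ to $\mathbb{R}^N$. Put $\Phi(x)=[A_1x,A_2x,\dots,A_Nx]\in\mathbb{R}^{n\times N}$ for $x\in\mathbb{R}^n$, and consider the system $$\dot x(t)=\Phi(x(t))u(t)=\sum_{i=1}^N A_ix(t)u_i(t),\qquad x(0)=\xi,$$ where $x:[0,T]\to\mathbb{R}^n$ is the (absolutely continuous) state trajectory generated by $u$, satisfying the differential equation for almost all $t\in[0,T]$. Original discrete-valued problem: among all controls $u$ such that, for almost all $t\in[0,T]$, $u_i(t)\in\{0,1\}$ for all $i\in\{1,\dots,N\}$ and $\sum_{i=1}^N u_i(t)=1$, find one that minimizes $J(u)=x(T)^\top Qx(T)$, where $x$ is the trajectory of the system $\dot x(t)=\Phi(x(t))u(t)$,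 $x(0)=\xi$, under $u$. Relaxed problem: let $$\mathcal{U}=\left\{u\in\mathbb{R}^N: u_i\in[0,1]\ (i=1,\dots,N),\ \sum_{i=1}^N u_i=1\right\}.$$ Among all controls $u$ such that $u(t)\in\mathcal{U}$ for almost all $t\in[0,T]$, find one that minimizes $$x(T)^\top Qx(T)+\lambda\int_0^T\psi(u(t))\,dt,$$ where $x$ is the trajectory of the system $\dot x(t)=\Phi(x(t))u(t)$, $x(0)=\xi$, under $u$. An optimal solution (or solution) of either problem is a feasible control attaining the minimum over all feasible controls. *)

(* Defs.v *)
From HB Require Import structures.
From mathcomp Require Import all_boot all_order all_algebra.
From mathcomp Require Import all_classical all_reals all_analysis.
Import Order.TTheory GRing.Theory Num.Theory.
Import numFieldNormedType.Exports.

Set Implicit Arguments.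
Unset Strict Implicit.
Unset Printing Implicit Defensive.

Local Open Scope classical_set_scope.
Local Open Scope ring_scope.

(* The real line with the sigma-algebra of Lebesgue-measurable sets, i.e. the
   domain of [completed_lebesgue_measure]; [R] itself carries the Borel sets. *)
Notation lebesgueType R := (caratheodory_type (mu_ext (@wlength R idfun))).

Section Definitions.
Context {R : realType}.

Notation mu := (@completed_lebesgue_measure R).

Definition positive_definite n (Q : 'M[R]_n) : Prop :=
  forall x : 'cV[R]_n, x != 0 -> 0 < (x^T *m Q *m x) 0 0.

Definition absolutely_continuous n (a b : R) (f : R -> 'cV[R]_n) : Prop :=
  forall e : R, 0 < e -> exists2 d : R, 0 < d &
    forall (k : nat) (l r : 'I_k -> R),
      (forall i, [/\ a <= l i, l i <= r i & r i <= b]) ->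
      trivIset setT (fun i => `]l i, r i[%classic) ->
      \sum_(i < k) (r i - l i) < d ->
      \sum_(i < k) `|f (r i) - f (l i)| < e.

Definition Phi n N (A : 'I_N -> 'M[R]_n) (x : 'cV[R]_n) : 'M[R]_(n, N) :=
  \matrix_(i < n, j < N) (A j *m x) i 0.

(* Controls and trajectories are total functions on [R]; only their restriction
   to [0, T] matters (the two-sided derivative at 0 and T is irrelevant, since
   the equation is only required almost everywhere). *)
Definition control N (T : R) (u : R -> 'cV[R]_N) : Prop :=
  forall i, measurable_fun (`[0, T]%classic : set (lebesgueType R))
              (fun t : lebesgueType R => u t i 0).

Definition trajectory n N (A : 'I_N -> 'M[R]_n) (xi : 'cV[R]_n) (T : R)
    (u : R -> 'cV[R]_N) (x : R -> 'cV[R]_n) : Prop :=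
  [/\ x 0 = xi,
      absolutely_continuous 0 T x &
      {ae mu, forall t : R, 0 <= t <= T ->
         is_derive t 1 x (Phi A (x t) *m u t)}].

Definition discrete_feasible N (T : R) (u : R -> 'cV[R]_N) : Prop :=
  control T u /\
  {ae mu, forall t : R, 0 <= t <= T ->
     (forall i, u t i 0 = 0 \/ u t i 0 = 1) /\ \sum_(i < N) u t i 0 = 1}.

Definition relaxed_set N : set 'cV[R]_N :=
  [set u | (forall i, 0 <= u i 0 <= 1) /\ \sum_(i < N) u i 0 = 1].

Definition relaxed_feasible N (T : R) (u : R -> 'cV[R]_N) : Prop :=
  control T u /\
  {ae mu, forall t : R, 0 <= t <= T -> relaxed_set (u t)}.

Definition terminal_cost n (Q : 'M[R]_n) (T : R) (x : R -> 'cV[R]_n) : R :=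
  ((x T)^T *m Q *m x T) 0 0.

(* The penalty is extended-real valued: [psi] is not assumed to be bounded. *)
Definition relaxed_cost n N (Q : 'M[R]_n) (T lambda : R) (psi : 'cV[R]_N -> R)
    (u : R -> 'cV[R]_N) (x : R -> 'cV[R]_n) : \bar R :=
  ((terminal_cost Q T x)%:E
   + lambda%:E * \int[mu]_(t in `[0%R, T]) (psi (u t))%:E)%E.

(* [x] is the (unique on [0, T]) trajectory generated by [u]. *)
Definition optimal n N (A : 'I_N -> 'M[R]_n) (xi : 'cV[R]_n) (T : R)
    (feasible : (R -> 'cV[R]_N) -> Prop)
    (cost : (R -> 'cV[R]_N) -> (R -> 'cV[R]_n) -> \bar R)
    (u : R -> 'cV[R]_N) : Prop :=
  feasible u /\
  exists2 x, trajectory A xi T u x &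
    forall v y, feasible v -> trajectory A xi T v y ->
      (cost u x <= cost v y)%E.

Definition discrete_optimal n N (A : 'I_N -> 'M[R]_n) (Q : 'M[R]_n)
    (xi : 'cV[R]_n) (T : R) (u : R -> 'cV[R]_N) : Prop :=
  optimal A xi T (discrete_feasible T)
    (fun _ x => (terminal_cost Q T x)%:E) u.

Definition relaxed_optimal n N (A : 'I_N -> 'M[R]_n) (Q : 'M[R]_n)
    (xi : 'cV[R]_n) (T lambda : R) (psi : 'cV[R]_N -> R)
    (u : R -> 'cV[R]_N) : Prop :=
  optimal A xi T (relaxed_feasible T) (relaxed_cost Q T lambda psi) u.

End Definitions.

(* Main.v *)
Require Import Defs.
From HB Require Import structures.
From mathcomp Require Import all_boot all_order all_algebra.
From mathcomp Require Import all_classical all_reals all_analysis.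
From mathcomp Require Import measurable_realfun ring lra.
Import Order.TTheory GRing.Theory Num.Theory.
Import numFieldNormedType.Exports.
Local Open Scope classical_set_scope.
Local Open Scope ring_scope.

(** The penalty vanishes along discrete-valued controls and is positive as soon
    as a relaxed control takes fractional values on a set of positive measure.
    A relaxed minimiser therefore has to be discrete-valued if discrete-valued
    controls can bring the terminal state arbitrarily close to that of any
    relaxed control (chattering): such a control would pay no penalty and almost
    the same terminal cost. Once the minimiser is known to be discrete-valued,
    the two costs agree on all discrete-valued controls, so it solves the
    discrete problem.

    The chattering step is [word_approximation]. A word is a finite list of
    pairs (mode [i], duration); following it means running the flows
    [exp (t A_i)] one after the other, and [word_trajectory] turns it into a
    piecewise constant control together with its trajectory. To approximate a
    relaxed trajectory [x], no integral of the control is taken: [P t], saying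
    that some word of duration [t] ends near [x t], is propagated from 0 to [T]
    by [real_induction]. Around a time [p] where the differential equation holds,
    a short step from [s] to [s'] is imitated by spending the fraction [u_i p] of
    the time [s' - s] in mode [i]; by the Euler estimates for words
    ([endpoint_euler]) the error is a small multiple of [s' - s]
    ([derivative_step]). The remaining times form a null set, covered by an open
    set [G] of small measure; a step inside [G] uses an arbitrary mode, and its
    error is controlled by the variation of [x] on that step and by its length.
    The steps inside [G] are disjoint and have small total length, so absolute
    continuity makes their total contribution small. Earlier errors grow by at
    most [exp (c t)], because words are Lipschitz in the initial state
    ([endpoint_lipschitz]). *)

(** * Real induction and chains of intervals *)

Section RealLine.
Context {R : realType}.

(** The supremum of the points of [P] belongs to [P] and cannot lie below [b].
    The step may only straddle a point [p], with a reach [d] depending on [p]: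
    this is the form in which a derivative at [p], or a neighbourhood of [p] in
    an open set, can be used. *)
Lemma real_induction (a b : R) (P : R -> Prop) : a <= b -> P a ->
  (forall p, a <= p <= b -> exists2 d, 0 < d &
     forall s s', a <= s -> s <= p -> p <= s' -> s' <= b ->
       p - d < s -> s' < p + d -> P s -> P s') ->
  P b.
Proof.
move=> ab Pa step; pose S := [set t | a <= t <= b /\ P t].
have Sa : S a by split => //; rewrite lexx.
have supS : has_sup S by split; [exists a|exists b => t [/andP[]]].
have p_in : a <= sup S <= b.
  apply/andP; split; first by apply: ub_le_sup => //; case: supS.
  by apply: ge_sup; [exists a|move=> t [/andP[]]].
have [d d0 stepd] := step _ p_in.
have [s [/andP[as_ sb] Ps] ps] := sup_adherent d0 supS.
have sp : s <= sup S by apply: ub_le_sup; [case: supS|split => //; apply/andP].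
have reach t : sup S <= t -> t <= b -> t < sup S + d -> P t.
  by move=> pt tb td; apply: (stepd s t).
have [bd|db] := ltP b (sup S + d).
  by apply: reach => //; case/andP: p_in.
have : sup S + d / 2 <= sup S.
  apply: ub_le_sup; first by case: supS.
  case/andP: p_in => p1 p2; split; first by apply/andP; split; lra.
  by apply: reach; lra.
by lra.
Qed.

(** Non-overlapping intervals, listed from right to left, so that a step to the
    right is recorded by a [cons]. *)
Fixpoint chain (a t : R) (I : seq (R * R)) : bool :=
  if I is lr :: I' then [&& chain a lr.1 I', lr.1 <= lr.2 & lr.2 <= t]
  else a <= t.

Definition total_length (I : seq (R * R)) : R := \sum_(p <- I) (p.2 - p.1).

Lemma chain_le a t I : chain a t I -> a <= t.
Proof.
by elim: I t => [|[l r] I IH] t //= /and3P[/IH al lr rt]; exact: le_trans al (le_trans lr rt).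
Qed.

Lemma chain_mono a t t' I : t <= t' -> chain a t I -> chain a t' I.
Proof.
case: I => [|[l r] I] tt' /=; first by move=> at_; exact: le_trans tt'.
by move=> /and3P[-> -> rt] /=; exact: le_trans tt'.
Qed.

Lemma chain_nth a t I i : chain a t I -> (i < size I)%N ->
  let p := nth (0, 0) I i in [/\ a <= p.1, p.1 <= p.2 & p.2 <= t].
Proof.
elim: I t i => [|[l r] I IH] t [|i] //= /and3P[ch lr rt] iI.
  by split => //; exact: chain_le ch.
have [h1 h2 h3] := IH _ _ ch iI; split => //.
by apply: le_trans h3 (le_trans lr rt).
Qed.

Lemma chain_nth_lt a t I i j : chain a t I -> (i < j < size I)%N ->
  (nth (0, 0) I j).2 <= (nth (0, 0) I i).1.
Proof.
elim: I t i j => [|[l r] I IH] t [|i] [|j] //=; rewrite ?andbF //.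
  by move=> /and3P[ch _ _] jI; case: (chain_nth _ _ _ _ ch jI).
by move=> /and3P[ch _ _]; exact: IH ch.
Qed.

(** Absolute continuity in the form in which a real induction, which builds its
    family of intervals one by one, consumes it. *)
Lemma ac_chain n (a b : R) (f : R -> 'cV[R]_n) : absolutely_continuous a b f ->
  forall e, 0 < e -> exists2 d, 0 < d &
    forall I, chain a b I -> total_length I < d ->
      \sum_(p <- I) `|f p.2 - f p.1| < e.
Proof.
move=> acf e e0; have [d d0 dP] := acf e e0; exists d => // I chI.
rewrite /total_length !(big_nth (0, 0)) !big_mkord => Id.
apply: (dP _ (fun i : 'I_(size I) => (nth (0, 0) I i).1)
             (fun i : 'I_(size I) => (nth (0, 0) I i).2)) => //.
- by move=> i; apply: chain_nth.
- have lt_absurd (i j : 'I_(size I)) z : (i < j)%N ->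
    (nth (0, 0) I i).1 < z -> z < (nth (0, 0) I j).2 -> False.
    move=> ij h1 h2; have := @chain_nth_lt a b I i j chI.
    by rewrite ij ltn_ord => /(_ isT); lra.
  apply/trivIsetP => /= i j _ _ ij; apply/seteqP; split => // z /=.
  rewrite !in_itv/= => -[/andP[h1 h2] /andP[h3 h4]].
  have [lt_ij|lt_ji|/val_inj eq_ij] := ltngtP i j.
  + exact: lt_absurd lt_ij h1 h4.
  + exact: lt_absurd lt_ji h3 h2.
  + by rewrite eq_ij eqxx in ij.
Qed.

Notation leb := (@lebesgue_measure R).

(** The interval [ ]l, r] ] at the head of the chain is disjoint from [ ]a, l] ],
    which contains the others; additivity of the measure then adds [r - l] to
    the bound for the tail. *)
Lemma chain_measure (G : set R) a t I : measurable G -> chain a t I ->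
  {in I, forall p : R * R, `]p.1, p.2]%classic `<=` G} ->
  ((total_length I)%:E <= leb (G `&` `]a, t]%classic))%E.
Proof.
move=> mG; elim: I t => [|[l r] I IH] t; first by rewrite /total_length big_nil.
move=> /= /and3P[ch lr rt] IG.
have IHl : ((total_length I)%:E <= leb (G `&` `]a, l]%classic))%E.
  by apply: IH ch _ => p pI; apply: IG; rewrite inE pI orbT.
rewrite /total_length big_cons/= -/(total_length I) addrC EFinD.
have -> : (r - l)%:E = leb (`]l, r]%classic : set R).
  rewrite lebesgue_measure_itv/= lte_fin -EFinB.
  by case: ltgtP lr => // -> _; rewrite subrr.
apply: (@le_trans _ _ (leb ((G `&` `]a, l]%classic) `|` `]l, r]%classic))).
  rewrite measureU//; first by apply: leeD2r.
  - exact: measurableI.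
  - apply/seteqP; split => // z /=; rewrite !in_itv/=; move=> [[_ /andP[_ h1]] /andP[h2 _]].
    by move: (lt_le_trans h2 h1); rewrite ltxx.
have al := chain_le _ _ _ ch.
apply: le_measure; rewrite ?inE.
- by apply: measurableU => //; exact: measurableI.
- exact: measurableI.
- move=> z [[Gz]|] /=; rewrite !in_itv/= => /andP[h1 h2].
    split => //; apply/andP; split => //; lra.
  split; last by apply/andP; split; lra.
  by apply: (IG (l, r)); rewrite ?inE ?eqxx//= in_itv/= h1 h2.
Qed.

(** The completed Lebesgue measure is the restriction of the Lebesgue outer
    measure, so outer regularity applies directly to the exceptional set. *)
Lemma null_open_cover (P : R -> Prop) (d : R) :
  {ae @completed_lebesgue_measure R, forall t : R, P t} -> 0 < d ->
  exists G, [/\ open G, forall t, ~ P t -> G t & (leb G < d%:E)%E].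
Proof.
move=> [N [mN N0 PN]] d0.
have d20 : 0 < d / 2 by rewrite divr_gt0.
have [G [oG NG Gle]] := @outer_measure_open_le R N _ d20.
exists G; split => // [t Pt|]; first exact/NG/PN.
apply: le_lt_trans Gle _; rewrite [X in (X + _)%E]N0 add0e lte_fin; lra.
Qed.

End RealLine.

(** * The flow of a constant matrix *)

(** Matrices are complete as a uniform space; repeated over a [realType], this
    makes them a complete normed module, as absolute convergence of matrix
    series requires. *)
HB.instance Definition _ (R : realType) (m n : nat) :=
  Uniform_isComplete.Build 'M[R]_(m, n) (@mx_complete R m n).

Section Norm.
Context {R : realType} {n : nat}.
Implicit Types (z : 'cV[R]_n) (A : 'M[R]_n).

Lemma entry_le_norm z j : `|z j 0| <= `|z|.
Proof.
rewrite [leRHS]/Num.Def.normr/= mx_normrE.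
exact: (le_bigmax _ (fun ij : 'I_n * 'I_1 => `|z ij.1 ij.2|) (j, 0)).
Qed.

Lemma norm_le_entries z (e : R) : 0 <= e -> (forall j, `|z j 0| <= e) -> `|z| <= e.
Proof.
move=> e0 ze; rewrite [leLHS]/Num.Def.normr/= mx_normrE.
by apply: bigmax_le => //= -[i j] _ /=; rewrite ord1.
Qed.

Lemma mulmx_bound (I : finType) (A : I -> 'M[R]_n) :
  exists2 c, 0 < c & forall i z, `|A i *m z| <= c * `|z|.
Proof.
pose a i := \sum_j \sum_k `|A i j k|.
have a0 i : 0 <= a i by apply: sumr_ge0 => j _; apply: sumr_ge0.
exists (1 + \sum_i a i); first by rewrite ltr_pwDl// sumr_ge0.
move=> i z; apply: (@le_trans _ _ (a i * `|z|)); last first.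
  rewrite ler_wpM2r// (bigD1 i)//=.
  have : 0 <= \sum_(j | j != i) a j by exact: sumr_ge0.
  lra.
apply: norm_le_entries => [|j]; first by rewrite mulr_ge0.
rewrite mxE (le_trans (ler_norm_sum _ _ _))//.
apply: (@le_trans _ _ (\sum_k `|A i j k| * `|z|)).
  by apply: ler_sum => k _; rewrite normrM ler_wpM2l// entry_le_norm.
rewrite -mulr_suml ler_wpM2r// /a [leRHS](bigD1 j)//= lerDl sumr_ge0// => k _.
exact: sumr_ge0.
Qed.

End Norm.

(** Multiply [1 - a <= expR (- a)] by [expR a]. *)
Lemma expR_sub1_le (R : realType) (a : R) : expR a - 1 <= a * expR a.
Proof.
have := expR_ge1Dx (- a); rewrite -(ler_pM2r (expR_gt0 a)) expRN mulVf ?gt_eqF ?expR_gt0//.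
lra.
Qed.

Lemma expR_sub1D_le (R : realType) (a : R) : 0 <= a ->
  expR a - 1 - a <= a * (a * expR a).
Proof.
move=> a0; have h := expR_sub1_le R a.
have := ler_wpM2l a0 h; lra.
Qed.

Section Flow.
Context {R : realType} {n : nat}.
Variable A : 'M[R]_n.
Implicit Types (z : 'cV[R]_n) (t : R).

(** [flow t z] is [exp (t A) z]. It is defined by its power series because the
    entries are then scalar power series, which can be differentiated
    termwise. *)
Definition flow_term t z (k : nat) : 'cV[R]_n :=
  exp_coeff t k *: iter k (mulmx A) z.

Definition flow t z : 'cV[R]_n := limn (series (flow_term t z)).

Section Bounds.
Variable c : R.
Hypotheses (c0 : 0 <= c) (Ac : forall z, `|A *m z| <= c * `|z|).

Lemma flow_term_norm t z k : `|flow_term t z k| <= `|z| * exp_coeff (c * `|t|) k.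
Proof.
have it : `|iter k (mulmx A) z| <= c ^+ k * `|z|.
  elim: k => [|k IH] /=; first by rewrite mul1r.
  by rewrite (le_trans (Ac _))// exprS -mulrA ler_wpM2l.
rewrite /flow_term normrZ /exp_coeff/= normrM normrX exprMn.
rewrite [X in _ * X * _]ger0_norm ?invr_ge0//.
set f := (_^-1); have f0 : 0 <= f by rewrite invr_ge0.
apply: (le_trans (ler_wpM2l _ it)); first by rewrite mulr_ge0// exprn_ge0.
by rewrite le_eqVlt; apply/orP; left; apply/eqP; ring.
Qed.

Lemma flow_cvg_bounded t z : series (flow_term t z) @ \oo --> flow t z.
Proof.
suff : cvgn (series (flow_term t z)) by [].
apply: normed_cvg; apply: series_le_cvg (flow_term_norm t z) _ => //.
- by move=> k; rewrite mulr_ge0// exp_coeff_ge0// mulr_ge0.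
- by apply: is_cvg_seriesZ; exact: is_cvg_series_exp_coeff.
Qed.

(** The exponential series of [c t] majorises that of the flow term by term,
    hence also the tails. The cases [m = 0, 1, 2] give the growth, continuity
    and Euler estimates [flow_norm], [flow_sub] and [flow_euler]. *)
Lemma flow_remainder m t z : 0 <= t ->
  `|flow t z - series (flow_term t z) m|
    <= `|z| * (expR (c * t) - series (exp_coeff (c * t)) m).
Proof.
move=> t0.
have cl : `|series (flow_term t z) k - series (flow_term t z) m| @[k --> \oo] -->
    `|flow t z - series (flow_term t z) m|.
  by apply: cvg_norm; apply: cvgB; [exact: flow_cvg_bounded|exact: cvg_cst].
have cr : `|z| * (series (exp_coeff (c * t)) k - series (exp_coeff (c * t)) m)
    @[k --> \oo] --> `|z| * (expR (c * t) - series (exp_coeff (c * t)) m).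
  apply: cvgM; first exact: cvg_cst.
  by apply: cvgB; [exact: is_cvg_series_exp_coeff|exact: cvg_cst].
apply: ler_cvg_to cl cr _; exists m => // k /= mk.
rewrite !sub_series_geq// mulr_sumr (le_trans (ler_norm_sum _ _ _))//.
by apply: ler_sum => i _; rewrite -[in leRHS](ger0_norm t0) flow_term_norm.
Qed.

End Bounds.

Lemma flow_cvg t z : series (flow_term t z) @ \oo --> flow t z.
Proof.
have [c c0 Ac] := mulmx_bound _ (fun _ : unit => A).
exact: (flow_cvg_bounded c (ltW c0) (Ac tt)).
Qed.

Lemma flowB t z z' : flow t (z - z') = flow t z - flow t z'.
Proof.
apply: cvg_lim => //.
rewrite (_ : series _ = series (flow_term t z) - series (flow_term t z')); last first.
  apply/funext => k; rewrite !fctE /series /= -sumrB; apply: eq_bigr => i _.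
  rewrite /flow_term -scalerBr; congr (_ *: _).
  by elim: i => [//|i /= ->]; rewrite mulmxBr.
by apply: cvgB; exact: flow_cvg.
Qed.

Lemma flow0 z : flow 0 z = z.
Proof.
apply: cvg_lim => //; rewrite -cvg_shiftS /=.
rewrite (_ : (fun k => _) = cst z); first exact: cvg_cst.
apply/funext => k; rewrite /series /= big_nat_recl//= big1 ?addr0.
  by rewrite /flow_term /exp_coeff/= divr1 scale1r.
by move=> i _; rewrite /flow_term /exp_coeff/= expr0n/= mul0r scale0r.
Qed.

Let entry_coeff z (j : 'I_n) (k : nat) : R := iter k (mulmx A) z j 0 / k`!%:R.

Let pseries_entry z j t : pseries (entry_coeff z j) t = (fun k => series (flow_term t z) k j 0).
Proof.
apply/funext => k; rewrite /pseries /series /= summxE; apply: eq_bigr => i _.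
by rewrite /flow_term !mxE /entry_coeff /exp_coeff/=; ring.
Qed.

Let entry_cvg z j t : pseries (entry_coeff z j) t @ \oo --> flow t z j 0.
Proof.
rewrite pseries_entry.
exact: (cvg_comp _ (fun M : 'cV[R]_n => M j 0) (flow_cvg t z) (@coord_continuous R n 1 j 0 _)).
Qed.

Let diffs_entry z j : pseries_diffs (entry_coeff z j) = entry_coeff (A *m z) j.
Proof.
apply/funext => k; rewrite /pseries_diffs /entry_coeff iterSr factS natrM.
by rewrite invfM mulrCA mulVKf.
Qed.

(** The termwise derivative of the flow is [flow t (A z)]; this identity turns it
    into the right-hand side of the differential equation. *)
Lemma flow_mulmx t z : flow t (A *m z) = A *m flow t z.
Proof.
apply/colP => j; rewrite mxE.
rewrite -(cvg_lim _ (entry_cvg (A *m z) j t))//; apply: cvg_lim => //.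
have h : \sum_m A j m * pseries (entry_coeff z m) t k @[k --> \oo] -->
    \sum_m A j m * flow t z m 0.
  by apply: cvg_big => [|m _]; [exact: add_continuous|apply: cvgMr; exact: entry_cvg].
rewrite (_ : pseries _ _ = fun k => \sum_m A j m * pseries (entry_coeff z m) t k)//.
apply/funext => k; under [RHS]eq_bigr do rewrite /pseries /series /= mulr_sumr.
rewrite [RHS]exchange_big/= /pseries /series/=; apply: eq_bigr => i _.
rewrite /entry_coeff -iterSr /= mxE !mulr_suml; apply: eq_bigr => m _.
by rewrite !mulrA.
Qed.

(** Differentiating the coefficients [(A^k z)_j / k!] shifts them into those of
    [A z]. Convergence everywhere provides the convergence at a point beyond
    [t] required to differentiate a power series. *)
Lemma flow_is_derive_entry t z (j : 'I_n) :
  is_derive t 1 (fun s => flow s z j 0) ((A *m flow t z) j 0).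
Proof.
have cv y s : cvgn (pseries (entry_coeff y j) s).
  by apply/cvg_ex; eexists; exact: entry_cvg.
have := @pseries_snd_diffs R (entry_coeff z j) (`|t| + 1) t (cv _ _).
rewrite !diffs_entry => /(_ (cv _ _) (cv _ _)).
rewrite [X in _ < X]ger0_norm ?addr_ge0// ltrDl ltr01 => /(_ isT).
rewrite (cvg_lim _ (entry_cvg _ _ _))// flow_mulmx.
by under eq_fun do rewrite (cvg_lim _ (entry_cvg _ _ _))//.
Qed.

End Flow.

Section Derivative.
Context {R : realType} {n : nat}.

(** The first-order expansion form of the derivative, with no division: it also
    covers [h = 0], and a difference of two such expansions gives the straddling
    estimates used in [derivative_step]. *)
Lemma is_derive_approx (f : R -> 'cV[R]_n) (p : R) (d : 'cV[R]_n) : is_derive p 1 f d <->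
  forall e : R, 0 < e -> exists2 r : R, 0 < r &
    forall h : R, `|h| < r -> `|f (p + h) - f p - h *: d| <= e * `|h|.
Proof.
split=> [fd e e0|H].
- have /cvgrPdist_le : h^-1 *: ((f \o shift p) (h *: 1) - f p) @[h --> 0^'] --> d.
    rewrite -(derive_val (is_derive := fd)); exact: (ex_derive (is_derive := fd)).
  move=> /(_ _ e0)[r /= r0 rP]; exists r => // h hr.
  have [->|h0] := eqVneq h 0; first by rewrite addr0 subrr scale0r subrr !normr0 mulr0.
  have := rP h; rewrite /ball_/= sub0r normrN => /(_ hr h0).
  rewrite -[leLHS](mulfK (x := `|h|)) ?normr_eq0// ler_pdivrMr ?normr_gt0//.
  rewrite mulrC -normrZ scalerBr scalerA divff// scale1r distrC.
  by rewrite [_%:A]mulr1 [h + p]addrC.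
- have cv : h^-1 *: ((f \o shift p) (h *: 1) - f p) @[h --> 0^'] --> d.
    apply/cvgrPdist_le => e e0; have [r r0 rP] := H e e0.
    exists r => //= h; rewrite /ball_/= sub0r normrN => hr h0.
    rewrite -(ler_pM2l (x := `|h|)) ?normr_gt0// -normrZ scalerBr scalerA divff//.
    rewrite scale1r distrC [_%:A]mulr1 [h + p]addrC.
    by rewrite [leRHS]mulrC; exact: rP.
  by apply: DeriveDef; [apply/cvg_ex; exists d|apply: cvg_lim].
Qed.

Lemma flow_is_derive (A : 'M[R]_n) z (t : R) :
  is_derive t 1 (fun s => flow A s z) (A *m flow A t z).
Proof.
have D := flow_is_derive_entry A t z.
have dv : derivable (fun s => flow A s z) t 1.
  by apply/derivable_mxP => i j; rewrite ord1; exact: (ex_derive (is_derive := D i)).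
apply: DeriveDef => //; rewrite derive_mx//; apply/colP => j.
by rewrite mxE (derive_val (is_derive := D j)).
Qed.

Lemma is_derive_shifted (f : R -> 'cV[R]_n) (a t : R) (d : 'cV[R]_n) :
  is_derive (t - a) 1 f d -> is_derive t 1 (fun s => f (s - a)) d.
Proof.
move=> /is_derive_approx fd; apply/is_derive_approx => e /fd[r r0 rP].
by exists r => // h /rP; rewrite [t + h - a]addrAC.
Qed.

(** Mean value theorem in each entry, the derivative [A (flow x z)] being bounded
    by [c exp (c b) |z|]. *)
Lemma flow_lipschitz (A : 'M[R]_n) z (b : R) : exists2 L : R, 0 <= L &
  forall s t : R, 0 <= s -> s <= t -> t <= b -> `|flow A t z - flow A s z| <= L * (t - s).
Proof.
have [c c0 Ac] := mulmx_bound _ (fun _ : unit => A); have {}Ac := Ac tt.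
exists (c * (`|z| * expR (c * b))); first by rewrite !mulr_ge0 ?expR_ge0// ltW.
move=> s t s0 st tb.
apply: norm_le_entries => [|j].
  by rewrite mulr_ge0 ?subr_ge0// !mulr_ge0 ?expR_ge0// ltW.
have D (x : R) : is_derive x 1 (fun s => flow A s z j 0) ((A *m flow A x z) j 0).
  exact: flow_is_derive_entry.
have [|x xst E] := MVT_segment st (fun x _ => D x).
  apply: derivable_within_continuous => x _; exact: (ex_derive (is_derive := D x)).
rewrite 2![in leLHS]mxE E normrM [X in _ * X]ger0_norm ?subr_ge0//.
rewrite ler_wpM2r ?subr_ge0// (le_trans (entry_le_norm _ _))// (le_trans (Ac _))//.
rewrite ler_wpM2l ?(ltW c0)//.
move: xst; rewrite in_itv/= => /andP[sx xt].
have := flow_remainder _ _ (ltW c0) Ac 0 x z (le_trans s0 sx).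
rewrite /series/= !big_geq// !subr0 => /le_trans; apply.
by rewrite ler_wpM2l// ler_expR ler_wpM2l ?(ltW c0)// (le_trans xt).
Qed.

End Derivative.

(** * Words of constant controls *)

Section Words.
Context {R : realType} {N n : nat}.
Variable A : 'I_N -> 'M[R]_n.
Implicit Types (w : seq ('I_N * R)) (z x : 'cV[R]_n).

Definition duration w : R := \sum_(p <- w) p.2.

Definition nonneg_word w : bool := all (fun p : 'I_N * R => 0 <= p.2) w.

Definition endpoint w z : 'cV[R]_n := foldl (fun z p => flow (A p.1) p.2 z) z w.

(** The increment predicted by one Euler step from [z], all modes being frozen
    at the initial state. *)
Definition drift w z : 'cV[R]_n := \sum_(p <- w) p.2 *: (A p.1 *m z).

Lemma duration_ge0 w : nonneg_word w -> 0 <= duration w.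
Proof. by move=> /allP w0; rewrite /duration big_seq; apply: sumr_ge0 => p /w0. Qed.

Lemma Phi_mulmx x (th : 'cV[R]_N) : Phi A x *m th = \sum_i th i 0 *: (A i *m x).
Proof.
apply/colP => j; rewrite summxE !mxE; apply: eq_bigr => i _.
by rewrite !mxE mulrC.
Qed.

Lemma Phi_delta x i : Phi A x *m delta_mx i 0 = A i *m x.
Proof.
rewrite Phi_mulmx (bigD1 i)//= mxE !eqxx scale1r big1 ?addr0// => j ji.
by rewrite mxE (negbTE ji) scale0r.
Qed.

Section Bounds.
Variable c : R.
Hypotheses (c0 : 0 <= c) (Ac : forall i z, `|A i *m z| <= c * `|z|).

Lemma Phi_norm x (th : 'cV[R]_N) : relaxed_set th -> `|Phi A x *m th| <= c * `|x|.
Proof.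
move=> [th01 th1]; rewrite Phi_mulmx (le_trans (ler_norm_sum _ _ _))//.
rewrite -[leRHS]mul1r -th1 mulr_suml; apply: ler_sum => i _.
by have /andP[t0 _] := th01 i; rewrite normrZ ger0_norm// ler_wpM2l.
Qed.

Lemma flow_norm i t z : 0 <= t -> `|flow (A i) t z| <= expR (c * t) * `|z|.
Proof.
move=> t0; have := flow_remainder _ _ c0 (Ac i) 0 t z t0.
by rewrite /series/= !big_geq// !subr0 mulrC.
Qed.

Lemma flow_euler i t z : 0 <= t ->
  `|flow (A i) t z - z - t *: (A i *m z)| <= `|z| * (expR (c * t) - 1 - c * t).
Proof.
move=> t0; have := flow_remainder _ _ c0 (Ac i) 2 t z t0.
rewrite /series/= !big_nat_recl//= !big_geq// !addr0 /flow_term /exp_coeff/=.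
by rewrite !expr0 !expr1 !divr1 scale1r opprD addrA opprD addrA.
Qed.

Lemma flow_sub i t z : 0 <= t -> `|flow (A i) t z - z| <= `|z| * (expR (c * t) - 1).
Proof.
move=> t0; have := flow_remainder _ _ c0 (Ac i) 1 t z t0.
rewrite /series/= !big_nat_recl//= !big_geq// !addr0 /flow_term /exp_coeff/=.
by rewrite !expr0 !divr1 scale1r.
Qed.

(** Each flow is linear, so a difference of initial states is carried by the flow
    itself and grows by at most the factor [exp (c d)]. *)
Lemma endpoint_lipschitz w z z' : nonneg_word w ->
  `|endpoint w z - endpoint w z'| <= expR (c * duration w) * `|z - z'|.
Proof.
elim: w z z' => [|[i d] w IH] z z' /=.
  by move=> _; rewrite /duration big_nil mulr0 expR0 mul1r.
move=> /andP[/= d0 w0]; rewrite /duration big_cons/= -/(duration w).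
rewrite (le_trans (IH _ _ w0))// mulrDr [_ + c * _]addrC expRD -mulrA.
by rewrite ler_wpM2l ?expR_ge0// -flowB flow_norm.
Qed.

(** The error depends on the word only through its duration, and is quadratic in
    it. Appending a mode of duration [d] to a word of duration [s] adds its
    own Euler error, taken at the current state, and the error of having frozen
    that state in the drift; the bounds telescope exactly thanks to
    [exp (c (s + d)) = exp (c s) exp (c d)]. *)
Lemma endpoint_euler w z : nonneg_word w ->
  `|endpoint w z - z - drift w z| <= `|z| * (expR (c * duration w) - 1 - c * duration w)
  /\ `|endpoint w z - z| <= `|z| * (expR (c * duration w) - 1).
Proof.
elim/last_ind: w => [|w [i d] IH].
  rewrite /duration /drift !big_nil /= !subrr normr0 mulr0 expR0 subrr subr0 mulr0.
  by split.
rewrite /nonneg_word all_rcons => /andP[/= d0 w0].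
have [IH1 IH2] := IH w0; have s0 := duration_ge0 _ w0.
rewrite /duration /drift -cats1 !big_cat/= !big_seq1/= -/(duration w) -/(drift w z).
rewrite cats1 /endpoint foldl_rcons/= -/(endpoint w z).
set y := endpoint w z in IH1 IH2 *; set s := duration w in s0 IH1 IH2 *.
have yz : `|y| <= `|z| * expR (c * s).
  rewrite -(subrK z y) (le_trans (ler_normD _ _))//.
  by move: IH2; rewrite mulrBr mulr1; lra.
have g0 : 0 <= expR (c * d) - 1 - c * d.
  by have := expR_ge1Dx (c * d); lra.
have cd0 : 0 <= c * d by rewrite mulr_ge0.
have f1 := flow_euler i d y d0; have f2 := flow_sub i d y d0.
split.
- have -> : flow (A i) d y - z - (drift w z + d *: (A i *m z)) =
    (flow (A i) d y - y - d *: (A i *m y)) + (y - z - drift w z) + d *: (A i *m (y - z)).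
    rewrite mulmxBr scalerBr; set a := d *: _; set b := d *: _.
    by apply/colP => j; rewrite !mxE; ring.
  apply: (le_trans (ler_normD _ _)).
  have f3 : `|d *: (A i *m (y - z))| <= d * (c * (`|z| * (expR (c * s) - 1))).
    rewrite normrZ ger0_norm// ler_wpM2l// (le_trans (Ac _ _))//.
    by rewrite ler_wpM2l.
  apply: (le_trans (lerD (ler_normD _ _) f3)).
  have f1' := le_trans f1 (ler_wpM2r g0 yz).
  apply: (le_trans (lerD (lerD f1' IH1) (lexx _))).
  rewrite le_eqVlt; apply/orP; left; apply/eqP; rewrite (mulrDr c) expRD; ring.
- have -> : flow (A i) d y - z = (flow (A i) d y - y) + (y - z) by rewrite addrA subrK.
  apply: (le_trans (ler_normD _ _)).
  have h0 : 0 <= expR (c * d) - 1 by lra.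
  apply: (le_trans (lerD (le_trans f2 (ler_wpM2r h0 yz)) IH2)).
  rewrite le_eqVlt; apply/orP; left; apply/eqP; rewrite (mulrDr c) expRD; ring.
Qed.

End Bounds.
End Words.

(** * A word is realised by a discrete-valued control *)

Section Realisation.
Context {R : realType} {N n : nat}.
Variable A : 'I_N -> 'M[R]_n.
Notation mu := (@completed_lebesgue_measure R).

Lemma lipschitz_ac (a b L : R) (f : R -> 'cV[R]_n) : 0 <= L ->
  (forall s t, a <= s -> s <= t -> t <= b -> `|f t - f s| <= L * (t - s)) ->
  absolutely_continuous a b f.
Proof.
move=> L0 lip e e0; have L1 : 0 < L + 1 by rewrite ltr_pwDr.
exists (e / (L + 1)); first by rewrite divr_gt0.
move=> k l r lr _; rewrite ltr_pdivlMr// => small; apply: le_lt_trans small.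
rewrite mulr_suml; apply: ler_sum => i _; have [al lri rb] := lr i.
rewrite (le_trans (lip _ _ al lri rb))// mulrC ler_wpM2l ?subr_ge0//.
by rewrite lerDl.
Qed.

Lemma ae_neq (a : R) : {ae mu, forall t : R, t != a}.
Proof.
exists [set a]; split; last by move=> t /= /negP; rewrite negbK => /eqP.
- by apply: sub_caratheodory => /=; exact: measurable_set1.
- exact: (@lebesgue_measure_set1 R a).
Qed.

Lemma ae_mono2 (P Q S : R -> Prop) : (forall t, P t -> Q t -> S t) ->
  {ae mu, forall t : R, P t} -> {ae mu, forall t : R, Q t} ->
  {ae mu, forall t : R, S t}.
Proof.
move=> PQS p q; have F := ae_filter_ringOfSetsType mu.
exact: (@filterS2 _ (almost_everywhere mu) F P Q S).
Qed.

(** Induction on the word from its end: the last mode is glued after the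
    trajectory of the preceding ones, so no time shift of a null set is ever
    needed. The conclusion is stronger than being a trajectory in order to
    survive the gluing: values of [v] and measurability everywhere, and a Lipschitz
    constant instead of absolute continuity. The end point is left out of the
    differential equation because the next mode creates a corner there. *)
Lemma realise_word (i0 : 'I_N) xi w : nonneg_word w ->
  exists (v : R -> 'cV[R]_N) (y : R -> 'cV[R]_n),
  [/\ forall t, exists i, v t = delta_mx i 0,
      forall i, measurable_fun setT (fun t : lebesgueType R => v t i 0),
      y 0 = xi /\ y (duration w) = endpoint A w xi,
      exists2 L, 0 <= L & forall s t, 0 <= s -> s <= t -> t <= duration w ->
        `|y t - y s| <= L * (t - s) &
      {ae mu, forall t : R, 0 < t < duration w ->
        is_derive t 1 y (Phi A (y t) *m v t)}].
Proof.
elim/last_ind: w => [|w [i d] IH].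
  move=> _; exists (fun=> delta_mx i0 0), (fun=> xi); split.
  - by move=> t; exists i0.
  - by move=> i; exact: measurable_cst.
  - by [].
  - by exists 0 => // s t _ _ _; rewrite subrr normr0 mul0r.
  - by apply: aeW => t; rewrite /duration big_nil; lra.
rewrite /nonneg_word all_rcons => /andP[/= d0 w0].
have [v [y [vd mv [y0 yT] [L L0 lip] dy]]] := IH w0.
have s0 := duration_ge0 _ w0.
have dE : duration (rcons w (i, d)) = duration w + d.
  by rewrite /duration -cats1 big_cat big_seq1.
rewrite dE; set s := duration w in s0 yT lip dy *.
pose z := endpoint A w xi.
exists (fun t => if t <= s then v t else delta_mx i 0).
exists (fun t => if t <= s then y t else flow (A i) (t - s) z); split.
- by move=> t; case: ifP => _; [exact: vd|exists i].
- move=> j; rewrite (_ : (fun t => _) =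
    (fun t : lebesgueType R =>
      if t <= s then v t j 0 else (delta_mx i 0 : 'cV[R]_N) j 0)); last first.
    by apply/funext => t; case: ifP.
  apply: measurable_fun_ifT => //.
  apply: (measurable_fun_bool true); rewrite setTI.
  apply: sub_caratheodory => /=.
  rewrite (_ : _ @^-1` _ = `]-oo, s]%classic); first exact: measurable_itv.
  by apply/seteqP; split => t /=; rewrite in_itv.
- split; first by rewrite s0.
  rewrite /endpoint foldl_rcons/= -/(endpoint A w xi) -/z.
  case: ifP => [|_]; last by rewrite addrC addKr.
  move=> h; have d00 : d = 0 by lra.
  by rewrite d00 addr0 flow0 yT.
- have [M M0 flip] := flow_lipschitz (A i) z d.
  exists (L + M); first exact: addr_ge0.
  move=> a b a0 ab bsd; case: (leP b s) => bs; case: (leP a s) => as_; try lra.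
  + rewrite (le_trans (lip _ _ a0 ab bs))// ler_wpM2r ?subr_ge0//; lra.
  + have e1 : `|flow (A i) (b - s) z - flow (A i) 0 z| <= M * (b - s - 0).
      by apply: flip; lra.
    have e2 := lip _ _ a0 as_ (lexx s).
    rewrite flow0 subr0 in e1; rewrite yT -/z in e2.
    rewrite -(subrKA z) (le_trans (ler_normD _ _))// (le_trans (lerD e1 e2))//.
    have -> : b - a = (b - s) + (s - a) by ring.
    rewrite [leRHS]mulrDr; apply: lerD; rewrite ler_wpM2r ?subr_ge0//; try lra.
  + have e1 : `|flow (A i) (b - s) z - flow (A i) (a - s) z| <= M * (b - s - (a - s)).
      by apply: flip; lra.
    rewrite (le_trans e1)//.
    have -> : b - s - (a - s) = b - a by ring.
    by rewrite ler_wpM2r ?subr_ge0//; lra.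
- apply: ae_mono2 _ dy (ae_neq s) => t dyt ts /andP[t0 tsd].
  have [lt_ts|lt_st|/eqP] := ltgtP t s; last by rewrite (negbTE ts).
  + apply: near_eq_is_derive; last by apply: dyt; rewrite t0.
    near=> x; rewrite ifT//; apply: ltW; near: x; exact: lt_nbhsl.
  + rewrite Phi_delta; apply: (@near_eq_is_derive _ _ _ (fun x => flow (A i) (x - s) z)).
      near=> x; rewrite ifF//; apply/negbTE; rewrite -ltNge; near: x; exact: lt_nbhsr.
    exact: (is_derive_shifted (fun x => flow (A i) x z) s t _ (flow_is_derive _ _ _)).
Unshelve. all: by end_near. Qed.

Lemma word_trajectory (i0 : 'I_N) xi w : nonneg_word w ->
  exists v y, [/\ discrete_feasible (duration w) v,
    trajectory A xi (duration w) v y & y (duration w) = endpoint A w xi].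
Proof.
move=> w0; have [v [y [vd mv [y0 yT] [L L0 lip] dy]]] := realise_word i0 xi w w0.
exists v, y; split => //; split => //.
- by move=> i; apply: measurable_funS (mv i).
- apply: aeW => t _; have [i ->] := vd t; split.
    by move=> j; rewrite mxE andbT; case: (j == i); [right|left].
  rewrite (bigD1 i)//= mxE !eqxx big1 ?addr0// => j ji.
  by rewrite mxE (negbTE ji).
- exact: lipschitz_ac L0 lip.
- apply: ae_mono2 _ dy (ae_mono2 _ _ _ (fun t => @conj _ _) (ae_neq 0) (ae_neq (duration w))).
  move=> t dyt [t0 tw] /andP[h1 h2].
  by apply: dyt; rewrite !lt_neqAle eq_sym t0 h1 tw h2.
Qed.

End Realisation.

(** * Every relaxed trajectory is a limit of words *)

(** Real induction, the variation on a short interval being less than 1. *)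
Lemma ac_bounded (R : realType) n (a b : R) (f : R -> 'cV[R]_n) : a <= b ->
  absolutely_continuous a b f ->
  exists2 B, 0 <= B & forall t, a <= t <= b -> `|f t| <= B.
Proof.
move=> ab acf; have [d d0 dP] := ac_chain _ _ _ _ acf 1 ltr01.
apply: (real_induction a b
  (fun t => exists2 B, 0 <= B & forall s, a <= s <= t -> `|f s| <= B)) => //.
  exists `|f a| => // s /andP[h1 h2].
  by rewrite (_ : s = a)//; apply/eqP; rewrite eq_le h1 h2.
move=> p _; exists (d / 2); first by rewrite divr_gt0.
move=> s s' as_ sp ps' s'b h1 h2 [B B0 BP]; exists (B + 1); first by rewrite addr_ge0.
move=> t /andP[at_ ts']; have [ts|st] := leP t s.
  by rewrite (le_trans (BP t _)) ?at_ ?ts// lerDl.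
have : \sum_(q <- [:: (s, t)]) `|f q.2 - f q.1| < 1.
  apply: dP => /=; first by rewrite as_ (ltW st) (le_trans ts').
  by rewrite /total_length big_seq1/=; lra.
rewrite big_seq1/= => ft.
rewrite -(subrK (f s) (f t)) (le_trans (ler_normD _ _))// addrC lerD ?(ltW ft)//.
by apply: BP; rewrite as_ lexx.
Qed.

Section Approximation.
Context {R : realType} {N n : nat}.
Variable A : 'I_N -> 'M[R]_n.

(** Time-sharing: the fraction [th_i] of the time [tau] is spent in mode [i]. *)
Definition control_word (th : 'cV[R]_N) (tau : R) : seq ('I_N * R) :=
  [seq (i, tau * th i 0) | i <- index_enum 'I_N].

Lemma control_word_duration th tau : relaxed_set th ->
  duration (control_word th tau) = tau.
Proof.
by move=> [_ th1]; rewrite /duration big_map -mulr_sumr th1 mulr1.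
Qed.

Lemma control_word_drift th tau z :
  drift A (control_word th tau) z = tau *: (Phi A z *m th).
Proof.
by rewrite /drift big_map Phi_mulmx scaler_sumr; apply: eq_bigr => i _; rewrite scalerA.
Qed.

Lemma control_word_nonneg th tau : relaxed_set th -> 0 <= tau ->
  nonneg_word (control_word th tau).
Proof.
move=> [th0 _] t0; rewrite /nonneg_word all_map; apply/allP => i _ /=.
by rewrite mulr_ge0//; case/andP: (th0 i).
Qed.

Lemma PhiB z z' (th : 'cV[R]_N) : Phi A (z - z') *m th = Phi A z *m th - Phi A z' *m th.
Proof.
by rewrite !Phi_mulmx -sumrB; apply: eq_bigr => i _; rewrite mulmxBr scalerBr.
Qed.

Section Bounds.
Variable c : R.
Hypotheses (c0 : 0 < c) (Ac : forall i (z : 'cV[R]_n), `|A i *m z| <= c * `|z|).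

(** Where the differential equation holds, time-sharing according to the value of
    the control imitates the trajectory up to [eta (s' - s)]. Three errors add
    up: the first-order expansion of [x] at [p], the replacement of [x p] by
    [x s] in the drift, and the Euler error of the word. The bound [B] on [x s]
    only serves to make the last one small. *)
Lemma derivative_step (x : R -> 'cV[R]_n) (p : R) (th : 'cV[R]_N) (eta B : R) :
  relaxed_set th -> is_derive p 1 x (Phi A (x p) *m th) -> 0 < eta -> 0 <= B ->
  exists2 r, 0 < r & forall s s', p - r < s -> s <= p -> p <= s' -> s' < p + r ->
    `|x s| <= B ->
    exists w, [/\ nonneg_word w, duration w = s' - s &
      `|x s' - endpoint A w (x s)| <= eta * (s' - s)].
Proof.
move=> thP; set d := Phi A (x p) *m th => dx eta0 B0.
have eta4 : 0 < eta / 4 by rewrite divr_gt0.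
have [r1 r10 dxP] := (is_derive_approx x p d).1 dx _ eta4.
(* [K2 * r] dominates the drift error and [K3 * (2 * r)] the Euler error, both
   per unit of time; [r <= 1 / 2] gives [tau <= 1], hence [expR c] in [K3]. *)
pose K2 := c * (`|d| + eta) + 1; pose K3 := B * (c * (c * expR c)) + 1.
have K20 : 0 < K2 by rewrite ltr_pwDr// mulr_ge0 ?(ltW c0)// addr_ge0// ltW.
have K30 : 0 < K3.
  by rewrite ltr_pwDr// mulr_ge0// !mulr_ge0 ?expR_ge0// ltW.
pose r := Num.min (Num.min r1 (eta / 4 / K2)) (Num.min (eta / 4 / K3 / 2) (1 / 2)).
have r0 : 0 < r by rewrite !lt_min r10 !divr_gt0.
exists r => // s s' ps sp ps' s'p xsB.
have [rr1 rr2] : r <= r1 /\ r <= eta / 4 / K2 by split; rewrite !ge_min lexx ?orbT.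
have [rr3 rr4] : r <= eta / 4 / K3 / 2 /\ r <= 1 / 2 by split; rewrite !ge_min lexx ?orbT.
set tau := s' - s; have tau0 : 0 <= tau by rewrite subr_ge0 (le_trans sp).
exists (control_word th tau); split; first exact: control_word_nonneg.
  exact: control_word_duration.
have := (endpoint_euler A c (ltW c0) Ac _ (x s) (control_word_nonneg th tau thP tau0)).1.
rewrite control_word_duration// control_word_drift; set E := endpoint _ _ _ => euler.
have e3 : `|E - x s - tau *: (Phi A (x s) *m th)| <= eta / 4 * tau.
  apply: (le_trans euler).
  have ct0 : 0 <= c * tau by rewrite mulr_ge0// ltW.
  have e3a := expR_sub1D_le R (c * tau) ct0.
  have ect : expR (c * tau) <= expR c.
    by rewrite ler_expR -[leRHS]mulr1 ler_wpM2l ?(ltW c0)// /tau; lra.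
  apply: (le_trans (ler_wpM2l (normr_ge0 _) e3a)).
  apply: (@le_trans _ _ (B * (c * tau * (c * tau * expR c)))).
    apply: ler_pM => //; last by rewrite !ler_wpM2l.
    by apply: mulr_ge0 => //; apply: mulr_ge0 => //; exact: expR_ge0.
  have -> : B * (c * tau * (c * tau * expR c)) = (B * (c * (c * expR c)) * tau) * tau by ring.
  rewrite ler_wpM2r//.
  apply: (@le_trans _ _ (K3 * (eta / 4 / K3))); last by rewrite mulrC divfK ?gt_eqF.
  apply: ler_pM => //.
  - by rewrite !mulr_ge0 ?expR_ge0// ltW.
  - by rewrite /K3 lerDl.
  - by rewrite /tau; lra.
have near_s : `|x s - x p - (s - p) *: d| <= eta / 4 * (p - s).
  have := dxP (s - p); have -> : p + (s - p) = s by ring.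
  rewrite distrC ger0_norm ?subr_ge0//; apply; lra.
have near_s' : `|x s' - x p - (s' - p) *: d| <= eta / 4 * (s' - p).
  have := dxP (s' - p); have -> : p + (s' - p) = s' by ring.
  rewrite ger0_norm ?subr_ge0//; apply; lra.
have e1 : `|x s' - x s - tau *: d| <= eta / 4 * tau.
  have -> : x s' - x s - tau *: d =
      (x s' - x p - (s' - p) *: d) - (x s - x p - (s - p) *: d).
    by apply/colP => j; rewrite !mxE /tau; ring.
  rewrite (le_trans (ler_normB _ _))// (le_trans (lerD near_s' near_s))//.
  by rewrite /tau; lra.
have e2 : `|tau *: (d - Phi A (x s) *m th)| <= eta / 4 * tau.
  rewrite normrZ ger0_norm// mulrC ler_wpM2r// -PhiB.
  rewrite (le_trans (Phi_norm A c Ac _ _ thP))// distrC.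
  have xsp : `|x s - x p| <= (`|d| + eta) * r.
    rewrite -(subrK ((s - p) *: d) (x s - x p)) (le_trans (ler_normD _ _))//.
    rewrite normrZ [`|s - p|]distrC [`|p - s|]ger0_norm ?subr_ge0//.
    rewrite (le_trans (lerD near_s (lexx _)))// [leRHS]mulrDl [leRHS]addrC lerD//.
      by apply: ler_pM; lra.
    by rewrite mulrC ler_wpM2l//; lra.
  apply: (@le_trans _ _ (K2 * (eta / 4 / K2))); last by rewrite mulrC divfK ?gt_eqF.
  apply: (le_trans (ler_wpM2l (ltW c0) xsp)); rewrite [leLHS]mulrA.
  apply: ler_pM => //; last by rewrite /K2 lerDl.
    by rewrite mulr_ge0 ?(ltW c0)// addr_ge0// ltW.
  exact: ltW.
have -> : x s' - E = (x s' - x s - tau *: d) + tau *: (d - Phi A (x s) *m th)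
    - (E - x s - tau *: (Phi A (x s) *m th)).
  by rewrite scalerBr; set a := tau *: d; set b := tau *: _; apply/colP => j; rewrite !mxE; ring.
rewrite (le_trans (ler_normB _ _))// (le_trans (lerD (le_trans (ler_normD _ _) (lerD e1 e2)) e3))//.
have := mulr_ge0 (ltW eta0) tau0; rewrite -/tau; lra.
Qed.

(** Chattering: the real induction described at the top of the file. The chain
    [I] in [P t] records the steps made inside [G]; its cost stays symbolic
    during the induction and is estimated only at time [T], where absolute
    continuity and the measure of [G] bound it all at once. *)
Lemma word_approximation (i0 : 'I_N) (T : R) xi u x : 0 <= T ->
  relaxed_feasible T u -> trajectory A xi T u x ->
  forall e, 0 < e -> exists w, [/\ nonneg_word w, duration w = T &
    `|x T - endpoint A w xi| <= e].
Proof.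
move=> T0 [_ uU] [x0 acx dx] e e0.
have [B B0 xB] := ac_bounded _ _ _ _ _ T0 acx.
(* [D * tau] bounds the displacement, during a time [tau], of a point of norm at
   most [B] under any of the flows. *)
pose D := B * (c * expR (c * T)).
have D0 : 0 <= D by rewrite !mulr_ge0 ?expR_ge0// ltW.
(* The final error is [eta * K]: apart from the growth factor, [T] comes
   from the derivative steps, [1] from the
   variation of [x] inside [G], [D] from the flows there. *)
pose K := expR (c * T) * (T + (1 + D)).
have K0 : 0 < K by rewrite mulr_gt0 ?expR_gt0// ltr_wpDl// ltr_pwDl.
pose eta := e / K; have eta0 : 0 < eta by rewrite divr_gt0.
have [del del0 delP] := ac_chain _ _ _ _ acx eta eta0.
have good := ae_mono2 _ _ _ (fun t => @conj _ _) dx uU.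
have m0 : 0 < Num.min del eta by rewrite lt_min del0.
have [G [oG badG Gsmall]] := null_open_cover _ _ good m0.
pose cost (I : seq (R * R)) := \sum_(q <- I) (`|x q.2 - x q.1| + D * (q.2 - q.1)).
pose P t := exists w I, [/\ nonneg_word w, duration w = t, chain 0 t I,
  {in I, forall q : R * R, `]q.1, q.2]%classic `<=` G} &
  `|x t - endpoint A w xi| <= expR (c * t) * (eta * t + cost I)].
suff : P T.
  move=> [w [I [w0 wT chI IG xw]]]; exists w; split => //.
  have mG := open_measurable oG.
  have : ((total_length I)%:E < (Num.min del eta)%:E)%E.
    apply: le_lt_trans Gsmall; apply: le_trans (chain_measure _ _ _ _ mG chI IG) _.
    by apply: le_measure; rewrite ?inE//; exact: measurableI.
  rewrite lte_fin lt_min => /andP[/delP - /(_ chI) varI lenI].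
  have costI : cost I <= eta * (1 + D).
    rewrite /cost big_split/= -mulr_sumr mulrDr mulr1 [eta * D]mulrC.
    by rewrite lerD ?ler_wpM2l// ltW.
  apply: (le_trans xw); rewrite (_ : e = expR (c * T) * (eta * (T + (1 + D)))).
    by rewrite ler_wpM2l ?expR_ge0// mulrDr lerD2l.
  by rewrite mulrCA -/K divfK ?gt_eqF.
apply: (real_induction 0 T P T0).
  exists [::], [::]; split => //.
  - by rewrite /duration big_nil.
  - by rewrite /= lexx.
  - by rewrite x0 subrr normr0 mulr_ge0 ?expR_ge0// /cost big_nil !mulr0 addr0.
move=> p pT.
have [[dp up]|] := pselect ((0 <= p <= T -> is_derive p 1 x (Phi A (x p) *m u p)) /\
  (0 <= p <= T -> relaxed_set (u p))).
- have [r r0 rP] := derivative_step x p (u p) eta B (up pT) (dp pT) eta0 B0.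
  exists r => // s s' s0 sp ps' s'T h1 h2 [w [I [w0 ws chI IG xw]]].
  have sT : 0 <= s <= T by rewrite s0 (le_trans sp)//; case/andP: pT.
  have [w' [w'0 w's xw']] := rP s s' h1 sp ps' h2 (xB _ sT).
  exists (w ++ w'), I; split => //.
  + by rewrite /nonneg_word all_cat; apply/andP.
  + by rewrite /duration big_cat/= -!/(duration _) ws w's addrC subrK.
  + by apply: chain_mono chI; exact: le_trans ps'.
  rewrite /endpoint foldl_cat -!/(endpoint A _ _).
  have con := endpoint_lipschitz A c (ltW c0) Ac w' (x s) (endpoint A w xi) w'0.
  rewrite -(subrKA (endpoint A w' (x s))) (le_trans (ler_normD _ _))//.
  have ss' : s <= s' by exact: le_trans ps'.
  rewrite w's in con; have := le_trans con (ler_wpM2l (expR_ge0 _) xw).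
  rewrite mulrA -expRD -mulrDr subrK => con'.
  apply: (le_trans (lerD xw' con')).
  have E1 : 1 <= expR (c * s').
    by rewrite -expR0 ler_expR mulr_ge0 ?(ltW c0)// (le_trans s0).
  have : eta * (s' - s) <= expR (c * s') * (eta * (s' - s)).
    by rewrite ler_peMl// mulr_ge0 ?subr_ge0// ltW.
  lra.
- move=> /badG Gp.
  have [r /= r0 rG] := (nbhs_ballP _ _).1 (open_nbhs_nbhs (conj oG Gp)).
  exists r => // s s' s0 sp ps' s'T h1 h2 [w [I [w0 ws chI IG xw]]].
  have sT : 0 <= s <= T by rewrite s0 (le_trans sp)//; case/andP: pT.
  have ss' : s <= s' by exact: le_trans ps'.
  have tau0 : 0 <= s' - s by rewrite subr_ge0.
  exists (rcons w (i0, s' - s)), ((s, s') :: I); split => //.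
  + by rewrite /nonneg_word all_rcons /= tau0.
  + by rewrite /duration -cats1 big_cat big_seq1/= -/(duration w) ws addrC subrK.
  + by rewrite /= chI ss' lexx.
  + move=> q; rewrite inE => /orP[/eqP->/= z|]; last exact: IG.
    rewrite /= in_itv/= => /andP[z1 z2]; apply: rG.
    by rewrite /ball/= ltr_norml; lra.
  rewrite /endpoint foldl_rcons -!/(endpoint A _ _)/= /cost big_cons/= -/(cost I).
  set y := endpoint A w xi in xw *.
  have f1 := flow_sub A c (ltW c0) Ac i0 _ (x s) tau0.
  have f2 := flow_norm A c (ltW c0) Ac i0 _ (x s - y) tau0; rewrite flowB in f2.
  have -> : x s' - flow (A i0) (s' - s) y = (x s' - x s) -
    (flow (A i0) (s' - s) (x s) - x s) + (flow (A i0) (s' - s) (x s) - flow (A i0) (s' - s) y).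
    by rewrite opprB !addrA subrK subrK.
  rewrite (le_trans (ler_normD _ _))//.
  have f3 := le_trans f2 (ler_wpM2l (expR_ge0 _) xw).
  rewrite mulrA -expRD -mulrDr subrK in f3.
  have ct0 : 0 <= c * (s' - s) by rewrite mulr_ge0// ltW.
  have f4 : `|x s| * (expR (c * (s' - s)) - 1) <= D * (s' - s).
    have g1 := expR_sub1_le R (c * (s' - s)).
    have g2 : expR (c * (s' - s)) <= expR (c * T).
      by rewrite ler_expR ler_wpM2l ?(ltW c0)//; lra.
    have g3 : expR (c * (s' - s)) - 1 <= c * expR (c * T) * (s' - s).
      apply: (le_trans g1); rewrite mulrAC ler_wpM2r// ler_wpM2l//; exact: ltW.
    rewrite /D -mulrA; apply: ler_pM => //; last exact: xB.
    by rewrite subr_ge0 -expR0 ler_expR.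
  apply: (le_trans (lerD (le_trans (ler_normB _ _) (lerD (lexx _) (le_trans f1 f4))) f3)).
  have E1 : 1 <= expR (c * s').
    by rewrite -expR0 ler_expR mulr_ge0 ?(ltW c0)// (le_trans s0).
  have k0 : 0 <= eta * (s' - s) + (`|x s' - x s| + D * (s' - s)).
    by rewrite !addr_ge0// mulr_ge0// ltW.
  have := ler_peMl k0 E1.
  have : 0 <= eta * (s' - s) by rewrite mulr_ge0// ltW.
  lra.
Qed.

End Bounds.
End Approximation.

(** * The penalty and the two optimisation problems *)

(** [y^T Q y - x^T Q x = y^T Q (y - x) + (y - x)^T Q x], and each of the two terms
    is bounded bilinearly. *)
Lemma quadratic_form_continuous (R : realType) n (Q : 'M[R]_n) (x : 'cV[R]_n) e :
  0 < e -> exists2 d, 0 < d & forall y, `|x - y| <= d ->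
    (y^T *m Q *m y) 0 0 <= (x^T *m Q *m x) 0 0 + e.
Proof.
move=> e0; have [c c0 Qc] := mulmx_bound _ (fun _ : unit => Q); have {}Qc := Qc tt.
have form_le (a b : 'cV[R]_n) : `|(a^T *m Q *m b) 0 0| <= n%:R * c * (`|a| * `|b|).
  rewrite -mulmxA mxE (le_trans (ler_norm_sum _ _ _))//.
  apply: (@le_trans _ _ (\sum_(k < n) `|a| * (c * `|b|))).
    apply: ler_sum => k _; rewrite mxE normrM ler_pM// ?entry_le_norm//.
    exact: le_trans (entry_le_norm _ _) (Qc b).
  rewrite sumr_const card_ord -mulr_natl le_eqVlt; apply/orP; left; apply/eqP; ring.
pose K := n%:R * c * (2 * `|x| + 1) + 1.
have K0 : 0 < K by rewrite ltr_pwDr// !mulr_ge0 ?addr_ge0 ?mulr_ge0// ltW.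
exists (Num.min 1 (e / K)); first by rewrite lt_min ltr01 divr_gt0.
move=> y; rewrite le_min => /andP[d1 dK].
have ybd : `|y| <= `|x| + 1.
  by rewrite -(subrK x y) (le_trans (ler_normD _ _))// addrC lerD// distrC.
have -> : (y^T *m Q *m y) 0 0 =
    (x^T *m Q *m x) 0 0 - ((y^T *m Q *m (x - y)) 0 0 + ((x - y)^T *m Q *m x) 0 0).
  rewrite mulmxBr linearB/= !mulmxBl.
  set a := _ *m y; set b := _ *m x; set b' := _ *m x.
  by rewrite [(b' - a) _ _]mxE [(- a) _ _]mxE [(b - b') _ _]mxE [(- b') _ _]mxE; ring.
rewrite lerD2l.
apply: (le_trans (ler_norm _)); rewrite normrN.
apply: (le_trans (ler_normD _ _)).
apply: (le_trans (lerD (form_le _ _) (form_le _ _))).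
apply: (@le_trans _ _ (K * (e / K))); last by rewrite mulrC divfK ?gt_eqF.
have -> : n%:R * c * (`|y| * `|x - y|) + n%:R * c * (`|x - y| * `|x|) =
  n%:R * c * (`|y| + `|x|) * `|x - y| by ring.
have nc0 : 0 <= n%:R * c by rewrite mulr_ge0// ltW.
apply: ler_pM => //; first by rewrite mulr_ge0// addr_ge0.
rewrite /K (@le_trans _ _ (n%:R * c * (2 * `|x| + 1)))// ?lerDl//.
by rewrite ler_wpM2l//; lra.
Qed.

Section Penalty.
Context {R : realType} {N : nat}.
Notation mu := (@completed_lebesgue_measure R).
Variables (psi : 'cV[R]_N -> R) (psi_ : 'I_N -> R -> R).
Hypotheses (mpsi : forall i, measurable_fun setT (psi_ i))
  (psiE : forall u : 'cV[R]_N, psi u = \sum_(i < N) psi_ i (u i 0))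
  (psi01 : forall i, psi_ i 0 = 0 /\ psi_ i 1 = 0)
  (psi_gt0 : forall i (s : R), 0 < s < 1 -> 0 < psi_ i s).

Lemma psi_coord_leif i s : 0 <= s <= 1 -> 0 <= psi_ i s ?= iff ((s == 0) || (s == 1)).
Proof.
move=> /andP[s0 s1]; have [p0 p1] := psi01 i.
have [->|sn0] := eqVneq s 0; first by rewrite p0; exact/leif_refl.
have [->|sn1] := eqVneq s 1; first by rewrite p1; exact/leif_refl.
have sgt : 0 < psi_ i s by apply: psi_gt0; rewrite !lt_neqAle sn1 s1 eq_sym sn0 s0.
by split; [exact: ltW|rewrite lt_eqF].
Qed.

Lemma psi_ge0 (u : 'cV[R]_N) : relaxed_set u -> 0 <= psi u.
Proof.
move=> [u01 _]; rewrite psiE; apply: sumr_ge0 => i _.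
exact: (psi_coord_leif i (u i 0) (u01 i)).1.
Qed.

(** A vanishing sum of nonnegative terms vanishes termwise, and [psi_ i] vanishes
    nowhere inside the unit interval. *)
Lemma psi_eq0_binary (u : 'cV[R]_N) : relaxed_set u -> psi u = 0 ->
  forall i, u i 0 = 0 \/ u i 0 = 1.
Proof.
move=> [u01 _]; rewrite psiE => /psumr_eq0P H i.
have [_] := psi_coord_leif i _ (u01 i).
rewrite H//; last by move=> j _; exact: (psi_coord_leif j _ (u01 j)).1.
by rewrite eqxx => /esym /orP[]/eqP->; [left|right].
Qed.

Lemma psi_binary (u : 'cV[R]_N) : (forall i, u i 0 = 0 \/ u i 0 = 1) -> psi u = 0.
Proof.
by move=> u01; rewrite psiE big1// => i _; have [p0 p1] := psi01 i; case: (u01 i) => ->.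
Qed.

Lemma measurable_psi (T : R) (u : R -> 'cV[R]_N) : control T u ->
  measurable_fun (`[0, T]%classic : set (lebesgueType R)) (fun t => psi (u t)).
Proof.
move=> mu_.
rewrite (_ : (fun t => _) = (fun t => \sum_(i < N) psi_ i (u t i 0))); last first.
  by apply/funext => t; rewrite psiE.
apply: measurable_sum => i; apply: measurableT_comp (mu_ i).
exact: mpsi.
Qed.

Let measurable_interval (T : R) : measurable (`[0, T]%classic : set (lebesgueType R)).
Proof. by apply: sub_caratheodory; exact: measurable_itv. Qed.

Lemma discrete_penalty (T : R) (u : R -> 'cV[R]_N) : discrete_feasible T u ->
  (\int[mu]_(t in `[0%R, T]) (psi (u t))%:E = 0)%E.
Proof.
move=> [mu_ u01].
rewrite (ae_eq_integral (cst 0%E)) ?integral_cst ?mul0e//.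
- by apply/measurable_EFinP; exact: measurable_psi.
- apply: (ae_mono2 _ _ _ _ u01 u01) => t ut _ /=; rewrite in_itv/= => /ut[u01t _].
  by rewrite psi_binary.
Qed.

(** The integrand is nonnegative only almost everywhere; passing to its absolute
    value gives access to the results on nonnegative integrands. *)
Lemma relaxed_penalty_abs (T : R) (u : R -> 'cV[R]_N) : relaxed_feasible T u ->
  (\int[mu]_(t in `[0%R, T]) (psi (u t))%:E =
   \int[mu]_(t in `[0%R, T]) `|(psi (u t))%:E|)%E.
Proof.
move=> [mu_ uU]; have mf := measurable_psi T u mu_.
apply: ae_eq_integral => //.
- exact/measurable_EFinP.
- by apply: measurableT_comp => //; apply/measurable_EFinP.
- apply: (ae_mono2 _ _ _ _ uU uU) => t ut _ /=; rewrite in_itv/= => /ut uUt.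
  by rewrite ger0_norm ?psi_ge0.
Qed.

Lemma relaxed_penalty_ge0 (T : R) (u : R -> 'cV[R]_N) : relaxed_feasible T u ->
  (0 <= \int[mu]_(t in `[0%R, T]) (psi (u t))%:E)%E.
Proof. by move=> /relaxed_penalty_abs ->; exact: integral_ge0. Qed.

Lemma penalty_eq0_discrete (T : R) (u : R -> 'cV[R]_N) : relaxed_feasible T u ->
  (\int[mu]_(t in `[0%R, T]) (psi (u t))%:E = 0)%E -> discrete_feasible T u.
Proof.
move=> uF; have [mu_ uU] := uF; rewrite relaxed_penalty_abs//.
have mf : measurable_fun (`[0, T]%classic : set (lebesgueType R)) (fun t => (psi (u t))%:E).
  by apply/measurable_EFinP; exact: measurable_psi.
move=> /(ae_eq_integral_abs mu (measurable_interval T) mf) ae0; split=> //.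
apply: ae_mono2 _ ae0 uU => t ut Ut tT; have uUt := Ut tT; split; last by case: uUt.
apply: psi_eq0_binary => //.
by have := ut; rewrite /= in_itv/= => /(_ tT)[].
Qed.

End Penalty.

Lemma discrete_feasible_relaxed (R : realType) N (T : R) (u : R -> 'cV[R]_N) :
  discrete_feasible T u -> relaxed_feasible T u.
Proof.
move=> [mu_ u01]; split=> //; apply: (ae_mono2 _ _ _ _ u01 u01) => t ut _ /ut[bin sum1].
by split=> // i; case: (bin i) => ->; rewrite ?lexx ?ler01.
Qed.

Theorem theorem1 (R : realType) (N n : nat) (hN : (1 <= N)%N) (hn : (1 <= n)%N)
  (T lambda : R) (hT : 0 < T) (hlambda : 0 < lambda)
  (xi : 'cV[R]_n) (A : 'I_N -> 'M[R]_n)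
  (Q : 'M[R]_n) (hQ : positive_definite Q)
  (psi : 'cV[R]_N -> R)
  (hpsi : exists psi_ : 'I_N -> R -> R,
     [/\ forall i, measurable_fun setT (psi_ i),
         forall u : 'cV[R]_N, psi u = \sum_(i < N) psi_ i (u i 0),
         forall i, psi_ i 0 = 0 /\ psi_ i 1 = 0 &
         forall i (s : R), 0 < s < 1 -> 0 < psi_ i s])
  (u : R -> 'cV[R]_N) :
  relaxed_optimal A Q xi T lambda psi u -> discrete_optimal A Q xi T u.
Proof.
case: hpsi => psi_ [mpsi psiE psi01 psi_gt0] [uF [x xu xmin]].
have disc0 v : discrete_feasible T v ->
    (\int[completed_lebesgue_measure]_(t in `[0%R, T]) (psi (v t))%:E = 0)%E.
  exact: discrete_penalty.
(* Chattering controls approach the terminal cost of [u] without penalty, so the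
   penalty of [u] is below every positive [e]. *)
have pen0 : (\int[completed_lebesgue_measure]_(t in `[0%R, T]) (psi (u t))%:E = 0)%E.
  apply/eqP; rewrite eq_le (relaxed_penalty_ge0 _ _ mpsi psiE psi01 psi_gt0)// andbT.
  rewrite -(pmule_rle0 _ (_ : 0 < lambda%:E)%E) ?lte_fin//.
  apply/lee_addgt0Pr => e e0; rewrite add0e.
  have [d d0 dP] := quadratic_form_continuous _ _ Q (x T) e e0.
  have [c c0 Ac] := mulmx_bound _ A.
  have [w [w0 wT xw]] :=
    word_approximation A c c0 Ac (Ordinal hN) T xi u x (ltW hT) uF xu d d0.
  have [v [y [vF yv yE]]] := word_trajectory A (Ordinal hN) xi w w0.
  rewrite wT in vF yv yE.
  have := xmin v y (discrete_feasible_relaxed _ _ _ _ vF) yv.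
  rewrite /relaxed_cost (disc0 v vF) mule0 adde0 => le_cost.
  have : ((terminal_cost Q T y)%:E <= (terminal_cost Q T x)%:E + e%:E)%E.
    by rewrite -EFinD lee_fin /terminal_cost yE; exact: dP.
  by move=> /(le_trans le_cost); rewrite leeD2lE.
have uD := penalty_eq0_discrete _ _ mpsi psiE psi01 psi_gt0 T u uF pen0.
split=> //; exists x => // v y vF yv.
have := xmin v y (discrete_feasible_relaxed _ _ _ _ vF) yv.
by rewrite /relaxed_cost (disc0 u uD) (disc0 v vF) mule0 !adde0.
Qed.
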